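(* Let $1\le M\le N$ and let $\beta\ge\lambda_1\ge\lambda_2\ge\cdots\ge\lambda_M\ge\alpha$ be ordered real random variables whose joint p.d.f. on the ordered region $\beta\ge x_1\ge\cdots\ge x_M\ge\alpha$ is $$f_{\boldsymbol\lambda}(\boldsymbol x)=K\,\det\boldsymbol\Phi(\boldsymbol x)\,\det\boldsymbol\Psi(\boldsymbol x)\prod_{i=1}^{M}\xi(x_i),$$ where $K$ is the normalizing constant, $\xi$ is a function, $\boldsymbol\Phi(\boldsymbol x)\in\mathbb C^{M\times M}$ has entries $\Phi_i(x_j)$, and $\boldsymbol\Psi(\boldsymbol x)\in\mathbb C^{N\times N}$ has entries $\Psi_i(x_j)$ for $j\le M$ and constants $\bar\Psi_{i,j}$ for $M<j\le N$. Let $1\le L\le M$ and $1\le i_1<i_2<\cdots<i_L\le M$. Then, for $\beta\ge x_{i_1}\ge x_{i_2}\ge\cdots\ge x_{i_L}\ge\alpha$, the joint p.d.f. of $\lambda_{i_1},\dots,\lambda_{i_L}$ is $$f_{\lambda_{i_1},\ldots,\lambda_{i_L}}(x_{i_1},\ldots,x_{i_L})=c(i_1,\ldots,i_L)\,K\,\mathcal T(\boldsymbol A),\qquad c(i_1,\ldots,i_L)=\frac{1}{\prod_{\ell=1}^{L+1}(i_\ell-i_{\ell-1}-1)!},$$ where $i_0=0$, $i_{L+1}=M+1$, and the $N\times N\times N$ tensor $\boldsymbol A$ has elements $$a_{i,j,k}=\begin{cases}\displaystyle\int_\alpha^\beta \varsigma_i(x)\Psi_j(x)\eta_k(x)\,dx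 & k\le M\\ 0 & k>M,\ i<k\\ \bar\Psi_{j,k} & k>M,\ i\ge k,\end{cases}$$ with $$\varsigma_i(x)=\begin{cases}\Phi_i(x)\xi(x)& i\le M\\ \xi(x)& i>M,\end{cases}\qquad \eta_k(x)=\begin{cases}\delta(x-x_k)& k\in\{i_1,\ldots,i_L\}\\ r\big(x;x_{i_{\varepsilon(k)}},x_{i_{\varepsilon(k)-1}}\big)&\text{otherwise.}\end{cases}$$ Here, for $k\le M$ with $k\notin\{i_1,\dots,i_L\}$, $\varepsilon(k)$ is the unique integer in $\{1,\dots,L+1\}$ such that $i_{\varepsilon(k)-1}\le k<i_{\varepsilon(k)}$, and by convention $x_{i_0}=\beta$ and $x_{i_{L+1}}=\alpha$.
   Context: For a rank-3 tensor $\boldsymbol A=\{a_{i,j,k}\}_{i,j,k=1,\dots,N}$ the pseudo-determinant is $\mathcal T(\boldsymbol A)=\sum_{\boldsymbol\mu}\operatorname{sgn}(\boldsymbol\mu)\sum_{\boldsymbol\alpha}\operatorname{sgn}(\boldsymbol\alpha)\prod_{k=1}^N a_{\mu_k,\alpha_k,k}$, where both sums run over all permutations of $\{1,\dots,N\}$. The function $r(x;a,b)$ equals $1$ if $a\le x\le b$ and $0$ otherwise. $\delta$ is the Dirac delta: $\int_\alpha^\beta g(x)\,\delta(x-x_k)\,dx$ means $g(x_k)$. The endpoints $\alpha<\beta$ may be infinite. The scalar functions $\Phi_i$ ($1\le i\le M$), $\Psi_i$ ($1\le i\le N$), $\xi$ and the constants $\bar\Psi_{i,j}$ are arbitrary,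 subject to the function $f_{\boldsymbol\lambda}(\boldsymbol x)=K\,\det\boldsymbol\Phi(\boldsymbol x)\,\det\boldsymbol\Psi(\boldsymbol x)\prod_{i=1}^{M}\xi(x_i)$ being a p.d.f. on the ordered region $\beta\ge x_1\ge\cdots\ge x_M\ge\alpha$ and to the integrals appearing being well defined (absolutely convergent). *)

(* Defs.v *)
From HB Require Import structures.
From mathcomp Require Import all_boot all_order all_fingroup all_algebra.
From mathcomp Require Import all_classical all_reals all_analysis.
From mathcomp Require Import complex.
Set Implicit Arguments.
Unset Strict Implicit.
Unset Printing Implicit Defensive.
Import Order.TTheory GRing.Theory Num.Theory.
Import numFieldNormedType.Exports.
Local Open Scope classical_set_scope.
Local Open Scope ring_scope.

Section cons_measure.
Context (R : realType) (n : nat).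
Variable m : {sigma_finite_measure set (n.-tuple (measurableTypeR R)) -> \bar R}.

Let cons_pair (p : measurableTypeR R * n.-tuple (measurableTypeR R)) :
  n.+1.-tuple (measurableTypeR R) := [tuple of p.1 :: p.2].

Let uncons (t : n.+1.-tuple (measurableTypeR R)) :
    measurableTypeR R * n.-tuple (measurableTypeR R) :=
  (thead t, [tuple of behead t]).

Let measurable_cons_pair : measurable_fun setT cons_pair.
Proof. exact: measurable_cons. Qed.

Let measurable_uncons : measurable_fun setT uncons.
Proof.
apply/measurable_fun_pairP; split; last exact: measurable_behead.
exact: measurable_tnth.
Qed.

Definition cons_measure : set (n.+1.-tuple (measurableTypeR R)) -> \bar R :=
  pushforward (lebesgue_measure \x m)%E cons_pair.

Let cons_measure0 : cons_measure set0 = 0%E.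
Proof. by rewrite /cons_measure /pushforward preimage_set0 measure0. Qed.

Let cons_measure_ge0 A : (0 <= cons_measure A)%E.
Proof. exact: measure_ge0. Qed.

Let cons_measure_sigma_additive : semi_sigma_additive cons_measure.
Proof.
move=> F mF tF mUF; rewrite /cons_measure /pushforward preimage_bigcup.
apply: measure_semi_sigma_additive.
- by move=> i; rewrite -[X in measurable X]setTI; exact: measurable_cons_pair.
- apply/trivIsetP => /= i j _ _ ij; rewrite -preimage_setI.
  by move/trivIsetP : tF => /(_ i j Logic.I Logic.I ij) ->; rewrite preimage_set0.
- rewrite -preimage_bigcup -[X in measurable X]setTI.
  exact: measurable_cons_pair.
Qed.

HB.instance Definition _ := isMeasure.Build _ _ _ cons_measure
  cons_measure0 cons_measure_ge0 cons_measure_sigma_additive.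

Let cons_measure_sigma_finite : sigma_finite setT cons_measure.
Proof.
have [F TF oF] := sigma_finiteT (@lebesgue_measure R).
have [G TG oG] := sigma_finiteT m.
have cover p : exists k, (\bigcup_(i < k.+1) F i `*` \bigcup_(i < k.+1) G i) p.
  have [i _ Fi] : (\bigcup_i F i) p.1 by rewrite -TF.
  have [j _ Gj] : (\bigcup_i G i) p.2 by rewrite -TG.
  exists (maxn i j); split.
    by exists i => //=; rewrite ltnS leq_maxl.
  by exists j => //=; rewrite ltnS leq_maxr.
have fin d (S : measurableType d) (mu : {measure set S -> \bar R}) (H : (set S)^nat) :
    (forall k, measurable (H k) /\ (mu (H k) < +oo)%E) -> forall k,
    measurable (\bigcup_(i < k) H i) /\ (mu (\bigcup_(i < k) H i) < +oo)%E.
  move=> oH k; split; first by apply: bigcup_measurable => i _; have [] := oH i.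
  rewrite bigcup_mkord; apply: (@le_lt_trans _ _ (\sum_(i < k) mu (H i))%E).
    have := @measureU2; elim: k => [|k IH] U2.
      by rewrite !big_ord0 measure0.
    rewrite !big_ord_recr /=; apply: (le_trans (U2 _ _ _ mu _ _ _ _)).
    - by apply: bigsetU_measurable => i _; have [] := oH i.
    - by have [] := oH k.
    - by rewrite leeD2r// IH.
  by rewrite lte_sum_pinfty// => i _; have [] := oH i.
exists (fun k => uncons @^-1` (\bigcup_(i < k.+1) F i `*` \bigcup_(i < k.+1) G i)).
  apply/esym/seteqP; split => // t _.
  by have [k kt] := cover (uncons t); exists k.
move=> k.
have [mF' lF] := fin _ _ _ _ oF k.+1.
have [mG' lG] := fin _ _ _ _ oG k.+1.
split.
  rewrite -[X in measurable X]setTI; apply: measurable_uncons => //.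
  exact: measurableX.
rewrite /cons_measure /pushforward -comp_preimage.
rewrite (_ : uncons \o cons_pair = id); last first.
  by apply/funext => -[a b]; congr pair; apply/val_inj.
rewrite preimage_id product_measure1E//.
by rewrite lte_mul_pinfty// ge0_fin_numE.
Qed.

HB.instance Definition _ := @Measure_isSigmaFinite.Build _ _ _ cons_measure
  cons_measure_sigma_finite.

End cons_measure.

(** Lebesgue measure on R^n, as the n-fold product measure on n-tuples; see
    [tuple_lebesgue_box]. *)
Fixpoint tuple_lebesgue (R : realType) (n : nat) :
    {sigma_finite_measure set (n.-tuple (measurableTypeR R)) -> \bar R} :=
  match n with
  | 0 => \d_([tuple] : 0.-tuple (measurableTypeR R))
  | n'.+1 => cons_measure (tuple_lebesgue R n')
  end.

Lemma tuple_lebesgue_box (R : realType) (n : nat)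
    (A : 'I_n -> set (measurableTypeR R)) :
  (forall i, measurable (A i)) ->
  tuple_lebesgue R n [set x | forall i, A i (tnth x i)] =
  (\prod_(i < n) lebesgue_measure (A i))%E.
Proof.
elim: n A => [|n IH] A mA.
  by rewrite big_ord0 /= diracE mem_set// => -[].
rewrite big_ord_recl -(IH (fun i => A (lift ord0 i)))//.
pose B := [set x : n.-tuple (measurableTypeR R) |
  forall i : 'I_n, A (lift ord0 i) (tnth x i)].
have mB : measurable B.
  rewrite (_ : B = \bigcap_(i in [set: 'I_n]) ((@tnth _ _)^~ i @^-1` A (lift ord0 i))).
    apply: fin_bigcap_measurable => // i _.
    by rewrite -[X in measurable X]setTI; exact: measurable_tnth.
  by apply/seteqP; split => x /= => [h i _|h i]; exact: h.
rewrite -(product_measure1E _ (tuple_lebesgue R n) (mA ord0) mB).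
congr (product_measure1 _ _ _); apply/seteqP; split => -[a x] /=.
  move=> h; split => /=; first exact: (h ord0).
  by move=> i; have := h (lift ord0 i); rewrite tnthS.
move=> [/= Aa Bx] i; have [->//|i0] := eqVneq i ord0.
have [j ->] : exists j, i = lift ord0 j.
  by have [j ij|] := unliftP ord0 i; [exists j|move/eqP; rewrite (negbTE i0)].
by rewrite tnthS; exact: Bx.
Qed.

(** The region [beta >= x_1 >= ... >= x_n >= alpha] *)
Definition ordered_region (R : realType) (alpha beta : \bar R) (n : nat) :
    set (n.-tuple (measurableTypeR R)) :=
  [set x | (forall i, (alpha <= (tnth x i)%:E <= beta)%E) /\
           (forall i j : 'I_n, (i <= j)%N -> tnth x j <= tnth x i)].

(** [joint_pdf_on P X D f]: the random vector [X] has the density on R^n equal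
    to [f] on [D] and to 0 outside [D]. The formulas for [f] are complex-valued;
    on [R[i]], [0 <= z] says that [z] is real and nonnegative. *)
Definition joint_pdf_on (R : realType) d (T : measurableType d)
    (P : probability T R) (n : nat) (X : 'I_n -> {RV P >-> R})
    (D : set (n.-tuple (measurableTypeR R)))
    (f : n.-tuple (measurableTypeR R) -> R[i]) : Prop :=
  let g := (fun x => complex.Re (f x)) \_ D in
  [/\ forall x, D x -> 0 <= f x,
      measurable_fun setT g &
      forall B : set (n.-tuple (measurableTypeR R)), measurable B ->
        P [set w | B [tuple X i w | i < n]] =
        (\int[tuple_lebesgue R n]_(x in B) (g x)%:E)%E].

Definition cintegrable (R : realType) (D : set (measurableTypeR R))
    (f : R -> R[i]) : Prop :=
  lebesgue_measure.-integrable D (fun t => (complex.Re (f t))%:E) /\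
  lebesgue_measure.-integrable D (fun t => (complex.Im (f t))%:E).

Definition cintegral (R : realType) (D : set (measurableTypeR R))
    (f : R -> R[i]) : R[i] :=
  Complex (\int[lebesgue_measure]_(t in D) complex.Re (f t))
          (\int[lebesgue_measure]_(t in D) complex.Im (f t)).

Definition pseudo_det (C : comNzRingType) (N : nat)
    (A : 'I_N -> 'I_N -> 'I_N -> C) : C :=
  \sum_(mu : 'S_N) (-1) ^+ mu *
    \sum_(al : 'S_N) (-1) ^+ al * \prod_(k < N) A (mu k) (al k) k.

Definition Phi_mx (R : realType) (M : nat) (Phi : 'I_M -> R -> R[i])
    (x : M.-tuple R) : 'M[R[i]]_M :=
  \matrix_(i, j) Phi i (tnth x j).

Definition Psi_mx (R : realType) (M N : nat) (Psi : 'I_N -> R -> R[i])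
    (Psibar : 'I_N -> 'I_N -> R[i]) (x : M.-tuple R) : 'M[R[i]]_N :=
  \matrix_(i, j) if insub (j : nat) is Some j' then Psi i (tnth x (j' : 'I_M))
                 else Psibar i j.

Definition r_fun (R : realType) (t : R) (a b : \bar R) : R[i] :=
  ((a <= t%:E <= b)%E : bool)%:R.

(** The indices i_1 < ... < i_L are given by [s : 'I_L -> 'I_M], with values
    counted from 0; [idx s l] is i_l counted from 1, with i_0 = 0 and
    i_{L+1} = M+1. Likewise [xpt alpha beta x l] is x_{i_l}, with
    x_{i_0} = beta and x_{i_{L+1}} = alpha. *)
Definition idx (L M : nat) (s : 'I_L -> 'I_M) (l : nat) : nat :=
  if l is l'.+1 then
    if insub l' is Some q then (s q).+1 else M.+1
  else 0.

Definition xpt (R : realType) (alpha beta : \bar R) (L : nat) (x : L.-tuple R)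
    (l : nat) : \bar R :=
  if l is l'.+1 then
    if insub l' is Some q then (tnth x q)%:E else alpha
  else beta.

(** The e in {1, ..., L+1} such that i_{e-1} <= k < i_e; see [epsilonP]. *)
Definition epsilon (L M : nat) (s : 'I_L -> 'I_M) (k : nat) : nat :=
  (odflt ord0 [pick e : 'I_L.+1 | (idx s e <= k < idx s e.+1)%N]).+1.

Lemma epsilonP (L M : nat) (s : 'I_L -> 'I_M) (k : nat) :
  (forall l l' : 'I_L, (l < l')%N -> (s l < s l')%N) -> (k <= M)%N ->
  forall e : nat, (0 < e <= L.+1)%N ->
    (idx s e.-1 <= k < idx s e)%N = (e == epsilon s k).
Proof.
move=> hs kM.
have idxL : idx s L.+1 = M.+1 by rewrite /= insubN// ltnn.
have mono1 l : (l <= L)%N -> (idx s l <= idx s l.+1)%N.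
  case: l => [//|l] lL; rewrite /= (insubT (fun i => i < L)%N lL).
  case: insubP => [q _ ql|_]; first by rewrite ltnS ltnW// hs//= ql.
  by rewrite ltnS ltnW.
have mono a b : (a <= b)%N -> (b <= L.+1)%N -> (idx s a <= idx s b)%N.
  move=> /subnKC <-; elim: (b - a)%N => [|c IH]; first by rewrite addn0.
  rewrite addnS => acL; apply: leq_trans (IH (ltnW acL)) _.
  exact: mono1.
have uniq e f : (f <= L)%N -> (e < f)%N ->
    (k < idx s e.+1)%N -> (idx s f <= k)%N -> false.
  move=> fL ef ke fk; have := leq_trans ke (leq_trans (mono _ _ ef (leqW fL)) fk).
  by rewrite ltnn.
move=> [//|e] /=; rewrite ltnS => eL; rewrite /epsilon eqSS.
case: pickP => [f /= /andP[fk kf]|none] /=.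
  apply/idP/eqP => [/andP[ek ke]|->]; last by apply/andP.
  have fL : (f <= L)%N by rewrite -ltnS.
  case: (ltngtP e f) => // h; first by have := uniq _ _ fL h ke fk.
  by have := uniq _ _ eL h kf ek.
have all_le l : (l <= L.+1)%N -> (idx s l <= k)%N.
  elim: l => [//|l IH] lL; have := none (Ordinal lL).
  by rewrite /= (IH (ltnW lL)) /= => /negbT; rewrite -leqNgt.
by have := all_le _ (leqnn _); rewrite idxL ltnNge kM.
Qed.

Definition varsigma (R : realType) (M N : nat) (Phi : 'I_M -> R -> R[i])
    (xi : R -> R[i]) (i : 'I_N) (t : R) : R[i] :=
  if insub (i : nat) is Some i' then Phi i' t * xi t else xi t.

(** The integrand [varsigma_i * Psi_j * eta_k] when k is not one of the i_l;
    [k] counts from 0. *)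
Definition rect_integrand (R : realType) (alpha beta : \bar R) (M N : nat)
    (Phi : 'I_M -> R -> R[i]) (Psi : 'I_N -> R -> R[i]) (xi : R -> R[i])
    (L : nat) (s : 'I_L -> 'I_M) (x : L.-tuple R) (i j k : 'I_N) (t : R) : R[i] :=
  let e := epsilon s k.+1 in
  varsigma Phi xi i t * Psi j t *
  r_fun t (xpt alpha beta x e) (xpt alpha beta x e.-1).

Definition interval_set (R : realType) (alpha beta : \bar R) :
    set (measurableTypeR R) :=
  [set t | (alpha <= t%:E <= beta)%E].

(** For k = i_l the integral against the Dirac delta is the value at x_{i_l}. *)
Definition tensorA (R : realType) (alpha beta : \bar R) (M N : nat)
    (Phi : 'I_M -> R -> R[i]) (Psi : 'I_N -> R -> R[i])
    (Psibar : 'I_N -> 'I_N -> R[i]) (xi : R -> R[i])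
    (L : nat) (s : 'I_L -> 'I_M) (x : L.-tuple R) (i j k : 'I_N) : R[i] :=
  if (k < M)%N then
    if [pick l | (s l == k :> nat)] is Some l then
      varsigma Phi xi i (tnth x l) * Psi j (tnth x l)
    else
      cintegral (interval_set alpha beta)
        (rect_integrand alpha beta Phi Psi xi s x i j k)
  else if (i < k)%N then 0 else Psibar j k.

Definition coef (R : realType) (L M : nat) (s : 'I_L -> 'I_M) : R[i] :=
  (\prod_(1 <= l < L.+2) (idx s l - idx s l.-1 - 1)`!)%N%:R^-1.

(* Main.v *)
Require Import Defs.
From HB Require Import structures.
From mathcomp Require Import all_boot all_order all_fingroup all_algebra.
From mathcomp Require Import all_classical all_reals all_analysis.
From mathcomp Require Import complex ring measurable_realfun.
Set Implicit Arguments.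
Unset Strict Implicit.
Unset Printing Implicit Defensive.
Import Order.TTheory GRing.Theory Num.Theory.
Import numFieldNormedType.Exports.
Local Open Scope ring_scope.

(** The joint density of the selected variables at [y] is the integral of the
    full density [f] over the remaining coordinates [z], restricted to the
    ordered region. Between two consecutive selected variables the remaining
    ones form a block of exchangeable coordinates: permuting [x] multiplies
    both determinants by the same sign, so [f] is a symmetric function
    ([density_symmetric]). Hence the ordered region may be replaced by the
    product of intervals where only the bounds given by [y] are kept, at the
    cost of dividing by the number of permutations inside the blocks, and this
    number is the inverse of the coefficient c ([coef_card]). On the product of
    intervals the pseudo-determinant is linear in each slice [k] of the tensor,
    so it commutes with integration: the integrand factors over the coordinates
    and each factor is one entry of the tensor [A]. The slices k > M make the
    first permutation of the pseudo-determinant fix every index above M, which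
    is expressed here by extending Phi to a block triangular N x N matrix whose
    second diagonal block is unitriangular ([det_varsigma_mx]); the
    pseudo-determinant of a tensor [U i k * V j k] is then a product of two
    determinants ([pseudo_det_scaled]).

    The replacement of the ordered region is done by averaging the truncated
    density over the block permutations ([symmetrized_density]). Averaging
    leaves the law of the selected variables unchanged, because the permutations
    fix the selected coordinates and preserve Lebesgue measure
    ([symmetrized_mass]). For a fixed [y], a point whose remaining coordinates
    are distinct and within their bounds is sorted by exactly one block
    permutation ([color_sorted_unique]), so that the average equals c times [f]
    there; ties form a null set ([tie_null]). Its integral over [z], computed by
    Fubini for products of functions of one variable
    ([has_cintegral_tuple]), is the announced formula
    ([integral_symmetrized]), at every [y] and not just almost everywhere: the
    formula is nonnegative because its integrand is, and it is measurable by
    Tonelli because it is an integral over [z] of a measurable nonnegative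
    function. *)

(** * Permutations preserving a coloring *)

(** The color classes below [n] are the blocks to be permuted; indices of color
    at least [n] are frozen. *)
Definition color_perms (T : finType) (c : T -> nat) (n : nat) : {set {perm T}} :=
  [set p : {perm T} | [forall k, c (p k) == c k] && [forall k, (n <= c k)%N ==> (p k == k)]].

Section ColorPerms.
Context (T : finType) (c : T -> nat).

Lemma color_permsP n (p : {perm T}) :
  reflect ((forall k, c (p k) = c k) /\ (forall k, (n <= c k)%N -> p k = k))
          (p \in color_perms c n).
Proof.
rewrite inE; apply: (iffP andP) => [[/forallP h1 /forallP h2]|[h1 h2]].
  split=> k; first exact/eqP/h1.
  by move=> nk; apply/eqP; have /implyP := h2 k; apply.
split; apply/forallP => k; first by rewrite h1.
by apply/implyP => /h2 ->.
Qed.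

Lemma group_set_color_perms n : group_set (color_perms c n).
Proof.
apply/group_setP; split=> [|p q /color_permsP[p1 p2] /color_permsP[q1 q2]].
  by apply/color_permsP; split=> k *; rewrite perm1.
by apply/color_permsP; split=> k *; rewrite permM ?q1 ?p1// p2 ?q2.
Qed.
Canonical color_perms_group n := Group (group_set_color_perms n).

(** Splitting off the last color: its class is stable under the permutation,
    whose restriction to that class is the second factor. *)
Lemma color_permsS n :
  color_perms c n.+1 = (color_perms c n * Sym [set k | c k == n])%g.
Proof.
set F := [set k | c k == n].
apply/setP => p; apply/idP/mulsgP.
- move=> /color_permsP[p1 p2].
  have pN : p \in ('N(F | 'P))%g.
    by apply/astabsP => k /=; rewrite !inE /aperm p1.
  pose r := restr_perm F p.
  exists (p * r^-1)%g r; last by rewrite mulgKV.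
    apply/color_permsP.
    have out k : c k != n -> (p * r^-1)%g k = p k.
      move=> kn; rewrite permM (out_perm (perm_onV (restr_perm_on F p)))//.
      by rewrite inE p1.
    have inn k : c k = n -> (p * r^-1)%g k = k.
      by move=> kn; rewrite permM -(restr_permE pN) ?permK// inE kn.
    split=> k; have [kn|kn] := eqVneq (c k) n.
    + by rewrite inn.
    + by rewrite out.
    + by rewrite inn.
    + by rewrite out// => nk; rewrite p2// ltn_neqAle eq_sym kn.
  by rewrite inE restr_perm_on.
- move=> [q r /color_permsP[q1 q2]]; rewrite inE => rF ->.
  apply/color_permsP; split=> k.
    rewrite permM; have [qF|qF] := boolP (q k \in F); last first.
      by rewrite (out_perm rF).
    have : r (q k) \in F by rewrite perm_closed.
    by move: qF; rewrite !inE -(q1 k) => /eqP -> /eqP ->.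
  move=> nk; rewrite permM q2 ?(ltnW nk)// (out_perm rF)//.
  by rewrite inE gtn_eqF.
Qed.

(** The group is the direct product of the symmetric groups of the classes. *)
Lemma card_color_perms n :
  #|color_perms c n| = (\prod_(j < n) (#|[set k | c k == j]|)`!)%N.
Proof.
elim: n => [|n IH].
  rewrite big_ord0; apply/eqP/cards1P; exists 1%g; apply/setP => p.
  rewrite finset.in_set1; apply/color_permsP/eqP.
    by move=> [_ h]; apply/permP => k; rewrite perm1 h.
  by move=> ->; split=> k *; rewrite perm1.
rewrite big_ord_recr /= color_permsS TI_cardMg ?IH.
  by rewrite /= -card_perm; congr (_ * _)%N; apply: eq_card => p; rewrite !inE.
apply/trivgP/fintype.subsetP => p /finset.setIP[/color_permsP[_ p2]]; rewrite !inE => pF.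
apply/eqP/permP => k; rewrite perm1; have [kF|kF] := boolP (c k == n).
  by apply: p2; rewrite (eqP kF).
by rewrite (out_perm pF)// inE.
Qed.

End ColorPerms.

(** * Sorting inside the color classes *)

Section SortingPerm.
Context (R : realFieldType) (M : nat) (c : 'I_M -> nat) (n : nat).

(** Decreasing order, as for the random variables of the statement; frozen
    indices are not compared. *)
Definition color_sorted (x : 'I_M -> R) :=
  [forall i : 'I_M, forall j : 'I_M, [&& (i <= j)%N, c i == c j & (c i < n)%N] ==> (x j <= x i)].

Lemma color_sortedP (x : 'I_M -> R) :
  reflect (forall i j : 'I_M, (i <= j)%N -> c i = c j -> (c i < n)%N -> x j <= x i)
          (color_sorted x).
Proof.
apply: (iffP forallP) => [h i j ij cij ci|h i].
  by have /forallP/(_ j)/implyP := h i; apply; rewrite ij cij eqxx -cij ci.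
by apply/forallP => j; apply/implyP => /and3P[ij /eqP cij ci]; apply: h.
Qed.

(** By the rearrangement inequality, a permutation maximizing the sum of the
    [x (p i)] weighted by the decreasing weights [M - i] is sorting: swapping an
    unsorted pair of the same class would increase the sum. *)
Lemma color_sorted_exists (x : 'I_M -> R) :
  exists2 p, p \in color_perms c n & color_sorted (x \o p).
Proof.
pose w (p : {perm 'I_M}) : R := \sum_(i < M) (M - i)%:R * x (p i).
have h1 : (1%g : {perm 'I_M}) \in color_perms c n by exact: group1.
case: (@Order.TotalTheory.arg_maxP _ _ _ 1%g (mem (color_perms c n)) w h1) => p pH pmax.
exists p => //; apply/color_sortedP => i j ij cij ci /=.
rewrite leNgt; apply/negP => xij.
have ij' : i != j by apply: contraTneq xij => ->; rewrite ltxx.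
have lij : (i < j)%N by rewrite ltn_neqAle ij'.
have qH : (tperm i j * p)%g \in color_perms c n.
  apply: groupM => //; apply/color_permsP; split=> k.
    by case: tpermP => // ->.
  by case: tpermP => // ->; rewrite -?cij leqNgt ci.
have pq : w (tperm i j * p)%g <= w p by exact: pmax.
move: pq; rewrite leNgt => /negP; apply.
(* Both sums agree outside [i] and [j], and the swap gains
   [(j - i) * (x (p j) - x (p i)) > 0]. *)
rewrite /w (bigD1 i)//= (bigD1 j)/=; last by rewrite eq_sym.
rewrite [ltRHS](bigD1 i)//= [in ltRHS](bigD1 j)/=; last by rewrite eq_sym.
rewrite !permM tpermL tpermR.
rewrite (eq_bigr (fun k : 'I_M => (M - k)%:R * x ((tperm i j * p)%g k))); last first.
  by move=> k /andP[ki kj]; rewrite permM tpermD// eq_sym.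
rewrite !addrA ltrD2r -subr_gt0.
rewrite !natrB ?(ltnW (ltn_ord _))//.
set a := x _; set b := x _.
have -> : (M%:R - i%:R) * a + (M%:R - j%:R) * b -
    ((M%:R - i%:R) * b + (M%:R - j%:R) * a) = (j%:R - i%:R) * (a - b) :> R by ring.
by rewrite mulr_gt0 ?subr_gt0 ?ltr_nat.
Qed.

(** Strong induction on [k]: if all smaller indices are fixed, neither the image
    nor the preimage of [k] can be smaller than [k], and if both are larger then
    [r] reverses the order of [k] and its preimage. *)
Lemma increasing_color_perm (r : {perm 'I_M}) : r \in color_perms c n ->
  (forall i j : 'I_M, (i < j)%N -> c i = c j -> (c i < n)%N -> (r i < r j)%N) ->
  r = 1%g.
Proof.
move=> rH rinc; apply/permP => k; rewrite perm1.
have [m] := ubnP (nat_of_ord k); elim: m k => // m IH k; rewrite ltnS => km.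
have /color_permsP[r1 r2] := rH.
have [ck|ck] := ltnP (c k) n; last exact: r2.
have fix_below (i : 'I_M) : (i < k)%N -> r i = i by move=> ik; apply: IH; apply: leq_trans km.
have [rk|rk|/val_inj//] := ltngtP (r k) k.
  by have /perm_inj := fix_below _ rk.
have [i ri] : exists i, r i = k by exists ((r^-1)%g k); rewrite permKV.
have ci : c i = c k by rewrite -r1 ri.
have [ik|ki|/val_inj ik] := ltngtP i k.
- by move: (ik); rewrite -(fix_below _ ik) ri ltnn.
- by have := rinc _ _ ki (esym ci) ck; rewrite ri ltnNge (ltnW rk).
- by rewrite -{1}ik.
Qed.

(** Two sorting permutations differ by a permutation that is increasing on each
    class, hence trivial. *)
Lemma color_sorted_unique (x : 'I_M -> R) :
  (forall i j : 'I_M, c i = c j -> (c i < n)%N -> x i = x j -> i = j) ->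
  exists p, forall q, (q \in color_perms c n) && color_sorted (x \o q) = (q == p).
Proof.
move=> xinj; have [p pH /color_sortedP ps] := color_sorted_exists x.
exists p => q; apply/idP/eqP => [/andP[qH /color_sortedP qs]|->]; last first.
  by rewrite pH; apply/color_sortedP.
suff -> : q = (q * p^-1 * p)%g.
  rewrite (_ : q * p^-1 = 1)%g ?mul1g//.
  apply: increasing_color_perm; first by rewrite groupM ?groupV.
  have /color_permsP[q1 _] := qH; have /color_permsP[p1 _] := pH.
  move=> i j ij cij ci; rewrite ltnNge; apply/negP => le.
  set r := (q * p^-1)%g in le *.
  have rE k : p (r k) = q k by rewrite permM permKV.
  have cr k : c (r k) = c k by rewrite -p1 rE q1.
  have := ps _ _ le; rewrite !cr => /(_ (esym cij)); rewrite -cij => /(_ ci) /=.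
  rewrite !rE => le1; have := qs _ _ (ltnW ij) cij ci => /= le2.
  have /xinj : x (q i) = x (q j) by apply: le_anti; rewrite le1 le2.
  rewrite !q1 => /(_ cij ci) /perm_inj eij; by rewrite eij ltnn in ij.
by rewrite mulgKV.
Qed.

End SortingPerm.

Local Open Scope classical_set_scope.
Local Open Scope ring_scope.

(** * Lebesgue measure on tuples *)

Section TupleMeasure.
Context (R : realType).
Local Notation mR := (measurableTypeR R).
Local Notation mu n := (tuple_lebesgue R n).

Definition box n (A : 'I_n -> set mR) : set (n.-tuple mR) :=
  [set x | forall i, A i (tnth x i)].

Lemma box_setT n (i : 'I_n) (B : set mR) :
  box (fun j => if j == i then B else setT) = (@tnth _ mR)^~ i @^-1` B.
Proof.
apply/seteqP; split => x /=; first by move/(_ i); rewrite eqxx.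
by move=> Bx j; case: eqP => // ->.
Qed.

Lemma measurable_box n (A : 'I_n -> set mR) :
  (forall i, measurable (A i)) -> measurable (box A).
Proof.
move=> mA.
rewrite (_ : box A = \bigcap_(i in [set: 'I_n]) ((@tnth _ mR)^~ i @^-1` A i)).
  apply: fin_bigcap_measurable => // i _.
  by rewrite -[X in measurable X]setTI; exact: measurable_tnth.
by apply/seteqP; split => x /= => [h i _|h i]; exact: h.
Qed.

Lemma tuple_measurable_boxes n :
  @measurable _ (n.-tuple mR) = <<s [set box A | A in [set A | forall i, measurable (A i)]] >>.
Proof.
apply/seteqP; split; apply: smallest_sub.
- exact: smallest_sigma_algebra.
- elim/big_rec: _ => [|i X _ IH]; first by move=> ? [].
  move=> A [[B mB <-]|]; last exact: IH.
  apply: sub_sigma_algebra; exists (fun j => if j == i then B else setT).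
    by move=> j /=; case: ifP.
  by rewrite box_setT setTI.
- exact: sigma_algebra_measurable.
- by move=> _ [A mA <-]; exact: measurable_box.
Qed.

(** Boxes are stable under intersection, generate the sigma-algebra, and the
    cubes with vertices [-k] and [k] exhaust the space. *)
Lemma tuple_lebesgue_unique n (m : {measure set (n.-tuple mR) -> \bar R}) :
  (forall A : 'I_n -> set mR, (forall i, measurable (A i)) ->
     m (box A) = (\prod_(i < n) lebesgue_measure (A i))%E) ->
  forall B, measurable B -> mu n B = m B.
Proof.
move=> mE B mB.
apply: (measure_unique _
    (fun k => box (fun _ : 'I_n => [set` `[- (k%:R : R), k%:R]]))
    (tuple_measurable_boxes n)) => //.
- move=> _ _ [A mA <-] [A' mA' <-]; exists (fun i => A i `&` A' i).
    by move=> i; exact: measurableI.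
  apply/seteqP; split => x /= h; last by case: h => h1 h2 i; split.
  by split=> i; have [] := h i.
- by move=> k; eexists; last reflexivity.
- apply/seteqP; split => // x _.
  exists (\max_(i < n) Num.Def.archi_bound `|tnth x i : R|)%N => // i /=.
  rewrite in_itv /= -ler_norml ltW//.
  apply: (lt_le_trans (archi_boundP _)) => //.
  by rewrite ler_nat; exact: leq_bigmax.
- by move=> _ [A mA <-]; rewrite [LHS]tuple_lebesgue_box// mE.
- move=> k; rewrite [X in (X < _)%E]tuple_lebesgue_box//.
  have : (\prod_(i < n) (@lebesgue_measure R) [set` `[(- k%:R)%R, k%:R]])%E \is a fin_num.
    by apply: prode_fin_num => i _; rewrite lebesgue_measure_itv/=; case: ifP.
  by rewrite fin_numElt => /andP[].
Qed.

(** Any rearrangement or regrouping of coordinates turns integrals over tuples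
    into integrals over the source, as soon as preimages of boxes have the right
    mass. *)
Lemma tuple_lebesgue_transfer n d (X : measurableType d)
    (nu : {measure set X -> \bar R}) (phi : X -> n.-tuple mR) :
  measurable_fun setT phi ->
  (forall A : 'I_n -> set mR, (forall i, measurable (A i)) ->
     nu (phi @^-1` box A) = (\prod_(i < n) lebesgue_measure (A i))%E) ->
  forall G : n.-tuple mR -> \bar R, measurable_fun setT G ->
    (forall x, 0 <= G x)%E ->
  (\int[mu n]_x G x = \int[nu]_x G (phi x))%E.
Proof.
move=> mphi boxE G mG G0.
have := ge0_integral_pushforward mphi nu measurableT mG (fun x _ => G0 x).
rewrite preimage_setT => <-.
by apply: eq_measure_integral => A mA _; exact: tuple_lebesgue_unique.
Qed.

Definition perm_tuple n (p : 'S_n) (x : n.-tuple mR) : n.-tuple mR :=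
  [tuple tnth x (p i) | i < n].

Lemma measurable_perm_tuple n (p : 'S_n) : measurable_fun setT (perm_tuple p).
Proof.
apply/measurable_fun_tnthP => i.
rewrite (_ : _ \o _ = (@tnth _ mR)^~ (p i)); first exact: measurable_tnth.
by apply/funext => x /=; rewrite tnth_mktuple.
Qed.

Lemma integral_perm_tuple n (p : 'S_n) (G : n.-tuple mR -> \bar R) :
  measurable_fun setT G -> (forall x, 0 <= G x)%E ->
  (\int[mu n]_x G (perm_tuple p x) = \int[mu n]_x G x)%E.
Proof.
move=> mG G0; apply/esym/tuple_lebesgue_transfer => //.
  exact: measurable_perm_tuple.
move=> A mA.
rewrite (_ : perm_tuple p @^-1` box A = box (fun i => A ((p^-1)%g i))).
  rewrite [LHS]tuple_lebesgue_box// [RHS](reindex_inj (@perm_inj _ (p^-1)%g)).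
  by [].
apply/seteqP; split => x /= h i.
  by have := h ((p^-1)%g i); rewrite tnth_mktuple permKV.
by have := h (p i); rewrite tnth_mktuple permK.
Qed.

Section SplitCoordinates.
Context (M L : nat) (s : 'I_L -> 'I_M).

Definition unselected : {set 'I_M} := ~: [set s l | l : 'I_L]%SET.

(** The coordinates [s l] are read in [y] and the other ones, in increasing
    order, in [z]; the default value of [nth] is never reached. *)
Definition assemble (y : L.-tuple mR) (z : #|unselected|.-tuple mR) : M.-tuple mR :=
  [tuple if [pick l | s l == k] is Some l then tnth y l
         else nth 0 z (index k (enum unselected)) | k < M].

Hypothesis s_inj : injective s.

Lemma unselectedP k : reflect (forall l, s l != k) (k \in unselected).
Proof.
rewrite !inE; apply: (iffP idP) => [h l|h].
  by apply: contraNneq h => <-; exact: imset_f.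
by apply/negP => /imsetP[l _ kl]; have := h l; rewrite kl eqxx.
Qed.

Lemma pick_s l : [pick l' | s l' == s l] = Some l.
Proof. by case: pickP => [l' /eqP/s_inj ->//|/(_ l)]; rewrite eqxx. Qed.

Lemma pick_unselected k : k \in unselected -> [pick l | s l == k] = None.
Proof. by move=> /unselectedP h; case: pickP => // l; rewrite (negbTE (h l)). Qed.

Lemma tnth_assemble_s y z l : tnth (assemble y z) (s l) = tnth y l.
Proof. by rewrite tnth_mktuple pick_s. Qed.

Lemma tnth_assemble_unselected y z b : tnth (assemble y z) (enum_val b) = tnth z b.
Proof.
rewrite tnth_mktuple pick_unselected ?enum_valP//.
by rewrite (tnth_nth 0) index_uniq ?enum_uniq// -cardE.
Qed.

Lemma assemble_ind (Q : 'I_M -> Prop) :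
  (forall l, Q (s l)) -> (forall b : 'I_#|unselected|, Q (enum_val b)) -> forall k, Q k.
Proof.
move=> Qs Qr k; have [kr|] := boolP (k \in unselected).
  by rewrite -(enum_rankK_in kr kr).
by rewrite !inE negbK => /imsetP[l _ ->].
Qed.

Lemma big_assemble (T : Type) (idx : T) (op : Monoid.com_law idx) (F : 'I_M -> T) :
  \big[op/idx]_k F k =
  op (\big[op/idx]_l F (s l)) (\big[op/idx]_(b < #|unselected|) F (enum_val b)).
Proof.
rewrite (bigID (fun k => k \in unselected)) /= Monoid.mulmC; congr (op _ _); last first.
  by rewrite big_enum_val.
rewrite (eq_bigl (fun k => k \in [set s l | l : 'I_L]%SET)); last first.
  by move=> k; rewrite /= finset.in_setC negbK.
by rewrite big_imset; [exact: eq_bigl|move=> ? ? _ _ /s_inj].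
Qed.

Lemma measurable_assemble : measurable_fun setT (fun p => assemble p.1 p.2).
Proof.
apply/measurable_fun_tnthP; elim/assemble_ind => [l|b].
  rewrite (_ : _ \o _ = (@tnth _ mR)^~ l \o fst).
    by apply: measurableT_comp => //; exact: measurable_tnth.
  by apply/funext => p /=; rewrite tnth_assemble_s.
rewrite (_ : _ \o _ = (@tnth _ mR)^~ b \o snd).
  by apply: measurableT_comp => //; exact: measurable_tnth.
by apply/funext => p /=; rewrite tnth_assemble_unselected.
Qed.

Section Tonelli.
Context (G : M.-tuple mR -> \bar R).
Hypotheses (mG : measurable_fun setT G) (G0 : forall x, (0 <= G x)%E).

(** Lebesgue measure on M-tuples is the image under [assemble] of the product
    of the Lebesgue measures on the two groups of coordinates. *)
Lemma integral_assemble :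
  (\int[mu M]_x G x = \int[mu L]_y \int[mu #|unselected|]_z G (assemble y z))%E.
Proof.
rewrite (@tuple_lebesgue_transfer _ _ _ (mu L \x mu #|unselected|)%E
    (fun p => assemble p.1 p.2))//; last 2 first.
- exact: measurable_assemble.
- move=> A mA.
  rewrite (_ : _ @^-1` _ = box (fun l => A (s l)) `*` box (fun b => A (enum_val b))).
    rewrite [LHS]product_measure1E; try exact: measurable_box.
    rewrite [RHS]big_assemble; congr (_ * _)%E.
      exact: (tuple_lebesgue_box (A := fun l => A (s l))).
    exact: (tuple_lebesgue_box (A := fun b => A (enum_val b))).
  apply/seteqP; split=> -[y z] /= => [h|[h1 h2]].
    split=> [l|b] /=; first by have := h (s l); rewrite tnth_assemble_s.
    by have := h (enum_val b); rewrite tnth_assemble_unselected.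
  elim/assemble_ind => [l|b]; first by rewrite tnth_assemble_s; exact: h1.
  by rewrite tnth_assemble_unselected; exact: h2.
rewrite (@fubini_tonelli1 _ _ _ _ _ _ _ (fun p => G (assemble p.1 p.2)))//.
by apply: (measurableT_comp mG); exact: measurable_assemble.
Qed.

Lemma measurable_integral_assemble :
  measurable_fun setT (fun y => \int[mu #|unselected|]_z G (assemble y z))%E.
Proof.
apply: (@measurable_fun_fubini_tonelli_F _ _ _ _ _ _ (fun p => G (assemble p.1 p.2))) => //.
by apply: (measurableT_comp mG); exact: measurable_assemble.
Qed.

End Tonelli.

Lemma measurable_assemble_r (y : L.-tuple mR) : measurable_fun setT (assemble y).
Proof.
apply/measurable_fun_tnthP; elim/assemble_ind => [l|b].
  rewrite (_ : _ \o _ = cst (tnth y l)); first exact: measurable_cst.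
  by apply/funext => z /=; rewrite tnth_assemble_s.
rewrite (_ : _ \o _ = (@tnth _ mR)^~ b); first exact: measurable_tnth.
by apply/funext => z /=; rewrite tnth_assemble_unselected.
Qed.

End SplitCoordinates.

Lemma measurable_tie n (a b : 'I_n) :
  measurable [set x : n.-tuple mR | tnth x a = tnth x b].
Proof.
rewrite (_ : [set _ | _] = (fun x : n.-tuple mR => (tnth x a - tnth x b : R)) @^-1` [set 0]).
  rewrite -[X in measurable X]setTI; apply: measurable_funB => //;
    exact: measurable_tnth.
by apply/seteqP; split => x /= => [->|/eqP]; rewrite ?subrr// subr_eq0 => /eqP.
Qed.

(** Integrate first over all coordinates but [a]: each section fixes the
    coordinate [b], so it is a box with a side reduced to a point. *)
Lemma tie_null n (a b : 'I_n) : a != b ->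
  mu n [set x : n.-tuple mR | tnth x a = tnth x b] = 0%E.
Proof.
move=> ab; set E := [set _ | _].
have mE : measurable E := measurable_tie a b.
have -> : mu n E = (\int[mu n]_x (\1_E x)%:E)%E by rewrite integral_indic// setIT.
pose s := fun _ : 'I_1 => a.
have s_inj : injective s by move=> i j _; rewrite !ord1.
rewrite (integral_assemble s_inj); last 2 first.
- by apply/measurable_EFinP; exact: measurable_indic.
- by move=> x; rewrite lee_fin.
have br : b \in unselected s by apply/unselectedP => l; rewrite /s.
apply: integral0_eq => y _.
pose b' := enum_rank_in br b.
have b'E : enum_val b' = b by rewrite enum_rankK_in.
pose A := fun j => if j == b' then [set tnth y ord0 : mR] else setT.
have mA j : measurable (A j) by rewrite /A; case: ifP.
under eq_integral => z _.
  rewrite (_ : \1_E (assemble y z) = \1_(box A) z :> R); last first.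
    rewrite !indicE; congr (_%:R); congr nat_of_bool; apply/idP/idP;
      rewrite !in_setE box_setT /E /= -{1}b'E (tnth_assemble_s s_inj _ _ ord0);
      by rewrite tnth_assemble_unselected => ->.
  over.
rewrite integral_indic//; last exact: measurable_box.
rewrite setIT [LHS]tuple_lebesgue_box//.
by rewrite (bigD1 b')//= /A eqxx lebesgue_measure_set1 mul0e.
Qed.
End TupleMeasure.

(** * Integrals of complex-valued functions *)

Section RealIntegral.
Context d (T : measurableType d) (R : realType) (m : {measure set T -> \bar R}).
Implicit Types (f g : T -> R).

(** Integrability and value are carried together, so that linear combinations
    and products never need a separate integrability argument. *)
Definition has_integral f v : Prop :=
  m.-integrable setT (EFin \o f) /\ (\int[m]_x (f x)%:E = v%:E)%E.

Lemma has_integralD f g u v : has_integral f u -> has_integral g v ->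
  has_integral (fun x => f x + g x) (u + v).
Proof.
move=> [fi fu] [gi gv]; split; first exact: (integrableD measurableT fi gi).
by rewrite EFinD -fu -gv -(integralD measurableT fi gi).
Qed.

Lemma has_integralZ (k : R) f u : has_integral f u ->
  has_integral (fun x => k * f x) (k * u).
Proof.
move=> [fi fu]; split; first exact: (integrableZl measurableT k fi).
by rewrite EFinM -fu -(integralZl measurableT fi).
Qed.

Lemma has_integralB f g u v : has_integral f u -> has_integral g v ->
  has_integral (fun x => f x - g x) (u - v).
Proof.
move=> fu gv; have := has_integralD fu (has_integralZ (-1) gv).
rewrite mulN1r; congr has_integral.
by apply/funext => x; rewrite mulN1r.
Qed.

Definition has_cintegral (f : T -> R[i]) (v : R[i]) : Prop :=
  has_integral (fun x => complex.Re (f x)) (complex.Re v) /\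
  has_integral (fun x => complex.Im (f x)) (complex.Im v).

Lemma Re_add (a b : R[i]) : complex.Re (a + b) = complex.Re a + complex.Re b.
Proof. by case: a; case: b. Qed.
Lemma Im_add (a b : R[i]) : complex.Im (a + b) = complex.Im a + complex.Im b.
Proof. by case: a; case: b. Qed.
Lemma Re_mul (a b : R[i]) :
  complex.Re (a * b) = complex.Re a * complex.Re b - complex.Im a * complex.Im b.
Proof. by case: a; case: b. Qed.
Lemma Im_mul (a b : R[i]) :
  complex.Im (a * b) = complex.Re a * complex.Im b + complex.Im a * complex.Re b.
Proof. by case: a; case: b. Qed.

Lemma has_cintegralZ (k : R[i]) (f : T -> R[i]) (u : R[i]) : has_cintegral f u ->
  has_cintegral (fun x => k * f x) (k * u).
Proof.
move=> [fr fi]; split.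
- rewrite Re_mul; under [X in has_integral X]eq_fun do rewrite Re_mul.
  by apply: has_integralB; exact: has_integralZ.
- rewrite Im_mul; under [X in has_integral X]eq_fun do rewrite Im_mul.
  by apply: has_integralD; exact: has_integralZ.
Qed.

Lemma has_cintegral0 : has_cintegral (fun=> 0) 0.
Proof. by split; split; (exact: integrable0 || exact: integral0). Qed.

Lemma has_cintegral_sum (I : Type) (r : seq I) (f : I -> T -> R[i]) (v : I -> R[i]) :
  (forall i, has_cintegral (f i) (v i)) ->
  has_cintegral (fun x => \sum_(i <- r) f i x) (\sum_(i <- r) v i).
Proof.
move=> fv; elim: r => [|i r [IHr IHi]].
  by rewrite big_nil; under [X in has_cintegral X]eq_fun do rewrite big_nil;
     exact: has_cintegral0.
rewrite big_cons; under [X in has_cintegral X]eq_fun do rewrite big_cons.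
have [fr fi] := fv i; split.
- rewrite Re_add; under [X in has_integral X]eq_fun do rewrite Re_add.
  exact: has_integralD.
- rewrite Im_add; under [X in has_integral X]eq_fun do rewrite Im_add.
  exact: has_integralD.
Qed.

End RealIntegral.

Section ProductIntegral.
Context d1 d2 (T1 : measurableType d1) (T2 : measurableType d2) (R : realType).
Variables (m1 : {sigma_finite_measure set T1 -> \bar R})
          (m2 : {sigma_finite_measure set T2 -> \bar R}).

Lemma has_integral_prod (f : T1 -> R) (g : T2 -> R) (u v : R) :
  has_integral m1 f u -> has_integral m2 g v ->
  has_integral (m1 \x m2)%E (fun p => f p.1 * g p.2) (u * v).
Proof.
move=> [fi fu] [gi gv].
have mf : measurable_fun setT f by apply/measurable_EFinP; exact: (measurable_int m1).
have mg : measurable_fun setT g by apply/measurable_EFinP; exact: (measurable_int m2).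
have mfg : measurable_fun setT (fun p : T1 * T2 => (f p.1 * g p.2)%:E).
  apply/measurable_EFinP; apply: measurable_funM.
    exact: (measurableT_comp mf).
  exact: (measurableT_comp mg).
have /integrableP[_ foo] := fi; have /integrableP[_ goo] := gi.
have fg_int : (m1 \x m2)%E.-integrable setT (fun p : T1 * T2 => (f p.1 * g p.2)%:E).
  apply/integrable12ltyP => //.
  rewrite [X in (X < _)%E](_ : _ = \int[m1]_x `|(f x)%:E| * \int[m2]_y `|(g y)%:E|)%E.
    by apply: lte_mul_pinfty => //; [exact: integral_ge0|
      rewrite ge0_fin_numE//; exact: integral_ge0].
  rewrite -ge0_integralZr//; last 2 first.
  - by apply: measurableT_comp => //; exact/measurable_EFinP.
  - exact: integral_ge0.
  apply: eq_integral => x _; rewrite -ge0_integralZl//; last first.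
    by apply: measurableT_comp => //; exact/measurable_EFinP.
  by apply: eq_integral => y _; rewrite EFinM abseM.
split => //.
rewrite -(integral12_prod_meas1 fg_int) /fubini_F/= EFinM -fu.
rewrite -(integralZr measurableT fi).
apply: eq_integral => x _; rewrite -gv -(integralZl measurableT gi).
by apply: eq_integral => y _; rewrite EFinM.
Qed.

Lemma has_cintegral_prod (f : T1 -> R[i]) (g : T2 -> R[i]) (u v : R[i]) :
  has_cintegral m1 f u -> has_cintegral m2 g v ->
  has_cintegral (m1 \x m2)%E (fun p => f p.1 * g p.2) (u * v).
Proof.
move=> [fr fi] [gr gi]; split.
- rewrite Re_mul; under [X in has_integral _ X]eq_fun do rewrite Re_mul.
  exact: (has_integralB (has_integral_prod fr gr) (has_integral_prod fi gi)).
- rewrite Im_mul; under [X in has_integral _ X]eq_fun do rewrite Im_mul.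
  exact: (has_integralD (has_integral_prod fr gi) (has_integral_prod fi gr)).
Qed.

End ProductIntegral.

Section TupleIntegral.
Context (R : realType).
Local Notation mR := (measurableTypeR R).
Local Notation mu n := (tuple_lebesgue R n).
Local Notation leb := (@lebesgue_measure R).

Definition cons_tuple n (p : mR * n.-tuple mR) : n.+1.-tuple mR := [tuple of p.1 :: p.2].

Lemma measurable_cons_tuple n : measurable_fun setT (@cons_tuple n).
Proof. exact: measurable_cons. Qed.

Let uncons n (t : n.+1.-tuple mR) : mR * n.-tuple mR :=
  (thead t, [tuple of behead t]).

Let unconsK n : cancel (@uncons n) (@cons_tuple n).
Proof. by move=> t; rewrite [RHS]tuple_eta. Qed.

Let measurable_uncons n : measurable_fun setT (@uncons n).
Proof.
apply/measurable_fun_pairP; split; last exact: measurable_behead.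
exact: measurable_tnth.
Qed.

(** Measure on tuples is defined as an image under [cons_tuple]. Measurability
    of [f] comes from that of its composite, as [cons_tuple] has a measurable
    inverse. *)
Lemma has_cintegral_cons_tuple n (f : n.+1.-tuple mR -> R[i]) v :
  has_cintegral (leb \x mu n)%E (f \o @cons_tuple n) v -> has_cintegral (mu n.+1) f v.
Proof.
have H (g : n.+1.-tuple mR -> R) w :
    has_integral (leb \x mu n)%E (g \o @cons_tuple n) w -> has_integral (mu n.+1) g w.
  move=> [gi gw].
  have mg : measurable_fun setT (EFin \o g).
    rewrite (_ : _ \o _ = (EFin \o (g \o @cons_tuple n)) \o @uncons n).
      by apply: measurableT_comp; [exact: (measurable_int _ gi)|exact: measurable_uncons].
    by apply/funext => t /=; rewrite unconsK.
  split.
    exact: (@integrable_pushforward _ _ _ _ _ _ (@measurable_cons_tuple n) _ setT).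
  rewrite -gw; exact: (@integral_pushforward _ _ _ _ _ _ (@measurable_cons_tuple n) _ setT).
by move=> [fr fi]; split; exact: H.
Qed.

Lemma has_integral_tuple0 (f : 0.-tuple mR -> R) : has_integral (mu 0) f (f [tuple]).
Proof.
have -> : f = cst (f [tuple]) by apply/funext => x; rewrite tuple0.
split; first exact: (@finite_measure_integrable_cst _ _ _ (\d_([tuple] : 0.-tuple mR))).
by rewrite /= integral_dirac// diracT mul1e.
Qed.

Lemma has_cintegral_tuple n (f : 'I_n -> mR -> R[i]) (v : 'I_n -> R[i]) :
  (forall i, has_cintegral leb (f i) (v i)) ->
  has_cintegral (mu n) (fun x => \prod_(i < n) f i (tnth x i)) (\prod_(i < n) v i).
Proof.
elim: n f v => [|n IH] f v fv.
  rewrite big_ord0; under [X in has_cintegral _ X]eq_fun do rewrite big_ord0.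
  by split; exact: has_integral_tuple0.
apply: has_cintegral_cons_tuple; rewrite big_ord_recl.
have := has_cintegral_prod (fv ord0) (IH _ _ (fun i => fv (lift ord0 i))).
congr has_cintegral; apply/funext => p /=; rewrite big_ord_recl; congr (_ * _).
by apply: eq_bigr => i _; rewrite tnthS.
Qed.
End TupleIntegral.

(** * Pseudo-determinants of factored tensors *)

Lemma insub_ord n (k : 'I_n) : insub (k : nat) = Some k.
Proof. exact: valK. Qed.

Section PseudoDeterminant.

Lemma pseudo_det_scaled (C : comNzRingType) N (w : 'I_N -> C) (U V : 'M[C]_N) :
  pseudo_det (fun i j k => w k * (U i k * V j k)) =
  (\prod_k w k) * (\det U * \det V).
Proof.
rewrite -(det_tr U) -(det_tr V) /pseudo_det /determinant mulr_suml mulr_sumr.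
apply: eq_bigr => mu _; rewrite !mulr_sumr; apply: eq_bigr => al _.
rewrite !big_split /=.
rewrite [X in _ = _ * (_ * X * _)](eq_bigr (fun k => U (mu k) k)); last first.
  by move=> k _; rewrite mxE.
rewrite [X in _ = _ * (_ * (_ * X))](eq_bigr (fun k => V (al k) k)); last first.
  by move=> k _; rewrite mxE.
by rewrite [X in _ = _ * X]mulrACA [RHS]mulrCA -!mulrA.
Qed.

Context (R : realType) (M N : nat) (hMN : (M <= N)%N).
Context (Phi : 'I_M -> R -> R[i]) (Psi : 'I_N -> R -> R[i])
  (Psibar : 'I_N -> 'I_N -> R[i]) (xi : R -> R[i]).

(** The matrix of the first two tensor indices that pairs with [Psi_mx]: its
    last columns encode the vanishing of the tensor for k > M and i < k. *)
Definition varsigma_mx (x : M.-tuple R) : 'M[R[i]]_N :=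
  \matrix_(i, k) if insub (k : nat) is Some k' then varsigma Phi xi i (tnth x (k' : 'I_M))
                 else ((k <= i)%N : bool)%:R.

(** The upper right block is zero, the lower right one is unitriangular, and the
    factor xi scales the columns of the upper left one. *)
Lemma det_varsigma_mx (x : M.-tuple R) :
  \det (varsigma_mx x) = \det (Phi_mx Phi x) * \prod_(i < M) xi (tnth x i).
Proof.
have [r Nr] : exists r, N = (M + r)%N by exists (N - M)%N; rewrite subnKC.
rewrite /varsigma_mx; clear Psi Psibar hMN; subst N.
set A := \matrix_(_, _) _.
rewrite -[A]submxK.
have -> : ursubmx A = 0.
  apply/matrixP => i k; rewrite !mxE insubF /= ?ltnNge ?leq_addr//.
  by rewrite (_ : (_ <= _)%N = false)//; apply/negbTE; rewrite -ltnNge ltn_addr.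
have -> : ulsubmx A = Phi_mx Phi x *m diag_mx (\row_i xi (tnth x i)).
  by apply/matrixP => i k; rewrite mul_mx_diag !mxE /= insub_ord /varsigma insub_ord.
rewrite det_lblock det_mulmx det_diag.
rewrite [X in _ * X = _](_ : _ = 1) ?mulr1.
  by congr (_ * _); apply: eq_bigr => i _; rewrite mxE.
rewrite det_trig.
  apply: big1 => i _; rewrite !mxE insubF /= ?leqnn//.
  by rewrite ltnNge leq_addr.
apply/is_trig_mxP => i k ik; rewrite !mxE insubF /= ?ltnNge ?leq_addr//.
by rewrite leq_add2l leqNgt ik.
Qed.

Lemma det_Phi_mx_perm (p : 'S_M) (x : M.-tuple R) :
  \det (Phi_mx Phi [tuple tnth x (p i) | i < M]) = (-1) ^+ p * \det (Phi_mx Phi x).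
Proof.
rewrite (_ : Phi_mx _ _ = col_perm p (Phi_mx Phi x)).
  by rewrite col_permE det_mulmx det_perm odd_permV mulrC.
by apply/matrixP => i k; rewrite !mxE tnth_mktuple.
Qed.

(** The permutation acts on the first [M] columns only, that is by right
    multiplication by a permutation matrix extended by the identity. *)
Lemma det_Psi_mx_perm (p : 'S_M) (x : M.-tuple R) :
  \det (Psi_mx Psi Psibar [tuple tnth x (p i) | i < M]) =
  (-1) ^+ p * \det (Psi_mx Psi Psibar x).
Proof.
have [r Nr] : exists r, N = (M + r)%N by exists (N - M)%N; rewrite subnKC.
rewrite /Psi_mx; clear hMN; subst N.
set A := \matrix_(_, _) _; set B := \matrix_(_, _) _.
have -> : A = B *m block_mx (perm_mx p^-1) 0 0 1%:M.
  rewrite -[B]hsubmxK mul_row_block !mulmx0 addr0 add0r mulmx1 -col_permE -[A]hsubmxK.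
  congr row_mx; apply/matrixP => i k; rewrite !mxE /=.
    by rewrite !insub_ord tnth_mktuple.
  by rewrite !insubF//= ltnNge leq_addr.
by rewrite det_mulmx det_ublock det1 mulr1 det_perm odd_permV mulrC.
Qed.

Lemma density_symmetric (K : R[i]) (p : 'S_M) (x : M.-tuple R) :
  let f x := K * \det (Phi_mx Phi x) * \det (Psi_mx Psi Psibar x) *
             \prod_(i < M) xi (tnth x i) in
  f [tuple tnth x (p i) | i < M] = f x.
Proof.
rewrite /= det_Phi_mx_perm det_Psi_mx_perm; congr (_ * _); last first.
  rewrite [RHS](reindex_inj (@perm_inj _ p)).
  by apply: eq_bigr => i _; rewrite tnth_mktuple.
rewrite [LHS](_ : _ = ((-1) ^+ p * (-1) ^+ p) *
  (K * \det (Phi_mx Phi x) * \det (Psi_mx Psi Psibar x))); last first.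
  by rewrite [X in X * _]mulrCA mulrACA -!mulrA.
by rewrite -signr_addb addbb mul1r.
Qed.
End PseudoDeterminant.

(** * The ordered region and the blocks between selected indices *)

Section OrderedRegion.
Context (R : realType) (alpha beta : \bar R) (M L : nat) (s : 'I_L -> 'I_M).
Local Notation mR := (measurableTypeR R).
Hypothesis hs : forall l l' : 'I_L, (l < l')%N -> (s l < s l')%N.

Lemma increasing_le (l l' : 'I_L) : (l <= l')%N -> (s l <= s l')%N.
Proof. by rewrite leq_eqVlt => /predU1P[/val_inj -> //|/hs/ltnW]. Qed.

Lemma increasing_inj : injective s.
Proof.
by move=> l l' e; have [h|h|/val_inj//] := ltngtP l l'; have := hs h; rewrite e ltnn.
Qed.

Lemma idxS (l : 'I_L) : idx s l.+1 = (s l).+1.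
Proof. by rewrite /= insub_ord. Qed.

Lemma epsilon_bounds k : (0 < epsilon s k <= L.+1)%N.
Proof. by rewrite /epsilon; case: pickP => *; rewrite /= ?ltnS// -ltnS. Qed.

Lemma epsilon_idx (k : 'I_M) :
  (idx s (epsilon s k.+1).-1 <= k.+1 < idx s (epsilon s k.+1))%N.
Proof. by rewrite (epsilonP hs) ?epsilon_bounds. Qed.

(** All order arguments about the blocks go through this comparison of the
    block number of [k] with the position of a selected index. *)
Lemma lt_epsilon (k : 'I_M) (l : 'I_L) :
  (l.+1 < epsilon s k.+1)%N = (s l <= k)%N.
Proof.
have := epsilon_bounds k.+1; have := epsilon_idx k.
case: (epsilon s k.+1) => [//|e] /= /andP[lo hi]; rewrite ltnS => eL.
rewrite ltnS; apply/idP/idP => [le|lk].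
  case: e lo le {hi} eL => [//|e] lo le eL.
  have := increasing_le (l' := Ordinal eL) le; move/leq_trans; apply.
  by move: lo; rewrite -[e]/(val (Ordinal eL)) idxS ltnS.
rewrite ltnNge; apply/negP => el.
have eL' : (e < L)%N := leq_ltn_trans el (ltn_ord l).
move: hi; rewrite -[e]/(val (Ordinal eL')) [X in (_ < X)%N](idxS (Ordinal eL')) ltnS ltnNge.
by rewrite (leq_trans (increasing_le (l := Ordinal eL') el) lk).
Qed.

(** The blocks are numbered from 1 to L+1 by [epsilon]; the selected indices get
    a color above all of these, which makes them frozen. *)
Definition color (k : 'I_M) : nat :=
  if k \in unselected s then epsilon s k.+1 else L.+2.

Lemma color_lt k : (color k < L.+2)%N = (k \in unselected s).
Proof.
rewrite /color; case: ifP => _; last by rewrite ltnn.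
by have /andP[_] := epsilon_bounds k.+1; rewrite ltnS.
Qed.

(** The first inequality becomes strict because the left end of a block is a
    selected index. *)
Lemma color_idx k j : (0 < j <= L.+1)%N ->
  (color k == j) = (idx s j.-1 < k.+1 < idx s j)%N.
Proof.
move=> jL; have := epsilonP hs (ltn_ord k) jL => /= eE.
have jL2 : (j < L.+2)%N by case/andP: jL.
rewrite /color; case: ifPn => [kr|kr].
  rewrite eq_sym -eE [RHS]andbC [LHS]andbC; congr (_ && _).
  rewrite leq_eqVlt; case: eqP => //= jk; exfalso.
  move: jk; case: j jL {eE} jL2 => [//|[//|j]] /=; rewrite !ltnS => jL _.
  rewrite (insubT (fun i => i < L)%N jL) /= => -[/val_inj sk].
  by move/unselectedP: kr => /(_ (Ordinal jL)); rewrite sk eqxx.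
apply/esym; rewrite gtn_eqF//; apply/negP => /andP[lo hi].
move: eE; rewrite (ltnW lo) hi /= => /esym/eqP jE.
move: kr; rewrite !inE negbK => /imsetP[l _ kl].
have : (l.+1 < j)%N by rewrite jE lt_epsilon kl.
case: j jL jL2 lo hi jE => [//|[//|j]] /=; rewrite !ltnS => jL _.
rewrite (insubT (fun i => i < L)%N jL) /= => lo _ _ lj.
have := increasing_le (l' := Ordinal jL) lj; rewrite -kl leqNgt => /negP; apply.
exact: lo.
Qed.

Lemma card_ord_interval n a b : (b <= n)%N ->
  #|[set k : 'I_n | (a <= k < b)%N]%SET| = (b - a)%N.
Proof.
move=> bn; rewrite -sum1_card.
have -> : (b - a = \sum_(a <= k < b) 1)%N by rewrite sum_nat_const_nat muln1.
rewrite (big_nat_widen _ _ _ _ _ bn) (big_nat_widenl _ 0%N)//= big_mkord.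
by apply: eq_bigl => k; rewrite inE andbC.
Qed.

(** Color 0 is empty and contributes 0! to the product over colors; color [j]
    is an interval of indices of the length that occurs in [coef]. *)
Lemma coef_card : coef R s = #|color_perms color L.+2|%:R^-1.
Proof.
rewrite /coef card_color_perms; congr (_%:R^-1).
rewrite [RHS]big_ord_recl [X in (X * _)%N](_ : _ = 1%N) ?mul1n; last first.
  rewrite (_ : [set k | _]%SET = finset.set0) ?cards0//.
  apply/setP => k; rewrite !inE; apply/negbTE; rewrite /color.
  by case: ifP => // _; have /andP[] := epsilon_bounds k.+1; case: epsilon.
rewrite big_add1 /= big_mkord; apply: eq_bigr => j _; congr (_`!).
have jL : (0 < (lift ord0 j : nat) <= L.+1)%N by rewrite lift0 ltn_ord.
rewrite (_ : [set k | _]%SET =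
    [set k : 'I_M | (idx s j <= k < (idx s j.+1).-1)%N]%SET); last first.
  apply/setP => k; rewrite !inE -[bump 0 j]/j.+1 color_idx// ltnS; congr (_ && _).
  by case: (idx s j.+1).
rewrite card_ord_interval; first by rewrite subn1 -predn_sub.
by rewrite /=; case: insubP => //= l _ _; exact: ltnW.
Qed.

Definition in_bounds (y : L.-tuple R) (k : 'I_M) (t : R) : bool :=
  (alpha <= t%:E <= beta)%E &&
  (xpt alpha beta y (epsilon s k.+1) <= t%:E <= xpt alpha beta y (epsilon s k.+1).-1)%E.

Definition selected (x : M.-tuple mR) : L.-tuple mR := [tuple tnth x (s l) | l < L].

Lemma measurable_selected : measurable_fun setT selected.
Proof.
apply/measurable_fun_tnthP => l.
rewrite (_ : _ \o _ = (@tnth _ mR)^~ (s l)); first exact: measurable_tnth.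
by apply/funext => x /=; rewrite tnth_mktuple.
Qed.

(** For the converse implication, two indices [i <= j] are compared through a
    selected index between them, unless both lie in the same block. *)
Lemma ordered_region_split (x : M.-tuple mR) :
  ordered_region alpha beta x <->
  [/\ ordered_region alpha beta (selected x),
      (forall k, k \in unselected s -> in_bounds (selected x) k (tnth x k)) &
      color_sorted color L.+2 (tnth x : 'I_M -> R)].
Proof.
split=> [[xab xd]|[[yab yd] xb /color_sortedP xs]].
- split.
  + split=> [l|l l' ll']; rewrite !tnth_mktuple//.
    by apply: xd; exact: increasing_le.
  + move=> k kr; rewrite /in_bounds xab andTb.
    have := lt_epsilon k; have := epsilon_bounds k.+1.
    case: (epsilon s k.+1) => [//|e] /=; rewrite ltnS => eL eE; apply/andP; split.
      case: insubP => [l _ le|_]; last by case/andP: (xab k).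
      rewrite tnth_mktuple lee_fin; apply/xd/ltnW.
      by rewrite ltnNge -eE ltnS -leqNgt le.
    case: e eL eE => [|e] /= eL eE; first by case/andP: (xab k).
    rewrite (insubT (fun i => i < L)%N eL) /= tnth_mktuple lee_fin; apply: xd.
    by rewrite -eE.
  + by apply/color_sortedP => i j ij _ _; exact: xd.
have lowb (i : 'I_M) (l : 'I_L) : (i <= s l)%N -> (tnth x (s l) <= tnth x i)%R.
  have [ir|ir] := boolP (i \in unselected s); last first.
    move: ir; rewrite !inE negbK => /imsetP[l' _ ->] ll'.
    have l'l : (l' <= l)%N by rewrite leqNgt; apply/negP => /hs; rewrite ltnNge ll'.
    by have := yd _ _ l'l; rewrite !tnth_mktuple.
  move=> il; have := lt_epsilon i l; have /andP[_ /andP[+ _]] := xb _ ir.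
  have := epsilon_bounds i.+1.
  have -> : (s l <= i)%N = false.
    apply/negbTE; rewrite -ltnNge ltn_neqAle il andbT eq_sym.
    by move/unselectedP: ir; exact.
  case: (epsilon s i.+1) => [//|e] _ /= + /negbT; rewrite -leqNgt ltnS => + el.
  have eL : (e < L)%N := leq_ltn_trans el (ltn_ord l).
  rewrite (insubT (fun i => i < L)%N eL) /= lee_fin; apply: le_trans.
  by have := yd (Ordinal eL) l el; rewrite !tnth_mktuple.
have upb (i : 'I_M) (l : 'I_L) : (s l <= i)%N -> (tnth x i <= tnth x (s l))%R.
  have [ir|ir] := boolP (i \in unselected s); last first.
    move: ir; rewrite !inE negbK => /imsetP[l' _ ->] ll'.
    have l'l : (l <= l')%N by rewrite leqNgt; apply/negP => /hs; rewrite ltnNge ll'.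
    by have := yd _ _ l'l; rewrite !tnth_mktuple.
  move=> il; have := lt_epsilon i l; have /andP[_ /andP[_ +]] := xb _ ir.
  have := epsilon_bounds i.+1; rewrite il.
  case: (epsilon s i.+1) => [//|[//|e]] /= eL + le; rewrite !ltnS in eL le *.
  rewrite (insubT (fun i => i < L)%N eL) /= lee_fin => /le_trans; apply.
  by have := yd l (Ordinal eL) le; rewrite !tnth_mktuple.
split=> [k|i j ij].
  have [kr|kr] := boolP (k \in unselected s); first by have /andP[] := xb _ kr.
  move: kr; rewrite !inE negbK => /imsetP[l _ ->].
  by have := yab l; rewrite tnth_mktuple.
have between l : (i <= s l)%N -> (s l <= j)%N -> (tnth x j <= tnth x i)%R.
  by move=> il lj; apply: le_trans (upb _ _ lj) (lowb _ _ il).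
have [ir|ir] := boolP (i \in unselected s); last first.
  by move: ir; rewrite !inE negbK => /imsetP[l _ il]; apply: (between l); rewrite -il.
have [jr|jr] := boolP (j \in unselected s); last first.
  by move: jr; rewrite !inE negbK => /imsetP[l _ jl]; apply: (between l); rewrite -jl.
have [eij|eij|eij] := ltngtP (epsilon s i.+1) (epsilon s j.+1).
- have eiL : ((epsilon s i.+1).-1 < L)%N.
    have /andP[e0 _] := epsilon_bounds i.+1; have /andP[_ eL] := epsilon_bounds j.+1.
    by rewrite -ltnS prednK//; exact: leq_trans eij eL.
  have ei : (Ordinal eiL).+1 = epsilon s i.+1.
    by apply: prednK; have /andP[] := epsilon_bounds i.+1.
  apply: (between (Ordinal eiL)).
    by rewrite ltnW// ltnNge -lt_epsilon ei ltnn.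
  by rewrite -lt_epsilon ei.
- exfalso.
  have ejL : ((epsilon s j.+1).-1 < L)%N.
    have /andP[e0 _] := epsilon_bounds j.+1; have /andP[_ eL] := epsilon_bounds i.+1.
    by rewrite -ltnS prednK//; exact: leq_trans eij eL.
  have ej : (Ordinal ejL).+1 = epsilon s j.+1.
    by apply: prednK; have /andP[] := epsilon_bounds j.+1.
  move: (eij); rewrite -ej lt_epsilon => /leq_trans/(_ ij).
  by rewrite -lt_epsilon ej ltnn.
- by apply: xs => //; [rewrite /color ir jr|rewrite color_lt].
Qed.

Lemma color_perms_selected p (x : M.-tuple mR) :
  p \in color_perms color L.+2 -> selected (perm_tuple p x) = selected x.
Proof.
move=> /color_permsP[_ p2]; apply: eq_from_tnth => l; rewrite !tnth_mktuple p2//.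
by rewrite leqNgt color_lt; apply/negP => /unselectedP/(_ l); rewrite eqxx.
Qed.

(** Block permutations preserve the bounds, since these depend only on the
    block; sorting is the only condition that changes. *)
Lemma ordered_region_perm_tuple p (x : M.-tuple mR) : p \in color_perms color L.+2 ->
  ordered_region alpha beta (perm_tuple p x) <->
  [/\ ordered_region alpha beta (selected x),
      (forall k, k \in unselected s -> in_bounds (selected x) k (tnth x k)) &
      color_sorted color L.+2 ((tnth x : 'I_M -> R) \o p)].
Proof.
move=> pH; rewrite ordered_region_split color_perms_selected//.
have -> : color_sorted color L.+2 (tnth (perm_tuple p x) : 'I_M -> R) =
          color_sorted color L.+2 ((tnth x : 'I_M -> R) \o p).
  by congr color_sorted; apply/funext => k; rewrite tnth_mktuple.
have /color_permsP[p1 _] := pH.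
have pr k : (p k \in unselected s) = (k \in unselected s) by rewrite -!color_lt p1.
have pe k : k \in unselected s -> epsilon s (p k).+1 = epsilon s k.+1.
  by move=> kr; have := p1 k; rewrite /color pr kr.
split=> -[h1 h2 h3]; split=> // k kr.
  have kr' : (p^-1)%g k \in unselected s by rewrite -pr permKV.
  by have := h2 _ kr'; rewrite /in_bounds tnth_mktuple -pe// permKV.
by have := h2 (p k); rewrite pr /in_bounds pe// tnth_mktuple; apply.
Qed.

End OrderedRegion.

(** * Integrating the tensor slice by slice *)

Section RestrictedIntegral.
Context (R : realType) (alpha beta : \bar R).
Local Notation leb := (@lebesgue_measure R).

Lemma measurable_interval_set : measurable (interval_set alpha beta).
Proof.
rewrite (_ : interval_set _ _ = EFin @^-1` [set` `[alpha, beta]]).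
  by rewrite -[X in measurable X]setTI; apply: EFin_measurable => //; exact: emeasurable_itv.
by apply/seteqP; split => t /=; rewrite in_itv.
Qed.

Lemma has_cintegral_interval (h : R -> R[i]) :
  cintegrable (interval_set alpha beta) h ->
  has_cintegral leb (fun t => if (alpha <= t%:E <= beta)%E then h t else 0)
    (cintegral (interval_set alpha beta) h).
Proof.
have H (g : R -> R) (g' : R -> R) :
    leb.-integrable (interval_set alpha beta) (fun t => (g t)%:E) ->
    (forall t, g' t = if (alpha <= t%:E <= beta)%E then g t else 0) ->
    has_integral leb g' (\int[leb]_(t in interval_set alpha beta) g t).
  move=> gi g'E.
  have E : EFin \o g' = (fun t => (g t)%:E) \_ (interval_set alpha beta).
    apply/funext => t /=; rewrite g'E patchE.
    have -> : (t \in interval_set alpha beta) = (alpha <= t%:E <= beta)%E.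
      by apply/idP/idP; rewrite in_setE.
    by case: ifP.
  have mI := measurable_interval_set.
  split; first by rewrite E; apply: (iffLR (integrable_mkcond _ mI)) gi.
  rewrite -[LHS]/(\int[leb]_t (EFin \o g') t)%E E -integral_mkcond /Rintegral fineK//.
  exact: integrable_fin_num gi.
move=> [hr hi]; split.
  by apply: (H (fun t => complex.Re (h t))) => // t; case: ifP.
by apply: (H (fun t => complex.Im (h t))) => // t; case: ifP.
Qed.

Local Notation mR := (measurableTypeR R).
Local Notation mu n := (tuple_lebesgue R n).

(** The slices [c b] depend on one integration variable each, the other slices
    are constant. *)
Lemma has_cintegral_partial_prod n q (c : 'I_q -> 'I_n)
    (F : 'I_n -> q.-tuple mR -> R[i]) (v : 'I_n -> R[i]) (g : 'I_q -> mR -> R[i]) :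
  injective c ->
  (forall b z, F (c b) z = g b (tnth z b)) ->
  (forall b, has_cintegral leb (g b) (v (c b))) ->
  (forall k z, k \in unselected c -> F k z = v k) ->
  has_cintegral (mu q) (fun z => \prod_(k < n) F k z) (\prod_(k < n) v k).
Proof.
move=> c_inj Fc gv Fr.
have := has_cintegralZ (\prod_(b < #|unselected c|) v (enum_val b)) (has_cintegral_tuple gv).
rewrite mulrC [\prod_(k < n) v k](big_assemble c_inj).
congr has_cintegral; apply/funext => z.
rewrite [RHS](big_assemble c_inj) /= mulrC; congr (_ * _).
  by apply: eq_bigr => b _; rewrite Fc.
by apply: eq_bigr => b _; rewrite Fr ?enum_valP.
Qed.

Lemma prod_indicator n (A : {set 'I_n}) (P : pred 'I_n) :
  \prod_(k in A) (P k)%:R = [forall k in A, P k]%:R :> R[i].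
Proof.
have [/forall_inP PA|] := boolP [forall k in A, P k].
  by apply: big1 => k kA; rewrite PA.
by case/forall_inPn => k kA Pk; rewrite (bigD1 k)//= (negbTE Pk) mul0r.
Qed.

End RestrictedIntegral.

(** * The marginal density *)

Section Marginal.
Context (R : realType) (M N : nat) (hMN : (M <= N)%N) (alpha beta : \bar R).
Context (K : R[i]) (Phi : 'I_M -> R -> R[i]) (Psi : 'I_N -> R -> R[i])
  (Psibar : 'I_N -> 'I_N -> R[i]) (xi : R -> R[i]).
Context (L : nat) (s : 'I_L -> 'I_M).
Local Notation mR := (measurableTypeR R).
Local Notation mu n := (tuple_lebesgue R n).
Local Notation q := #|unselected s|.
Hypothesis hs : forall l l' : 'I_L, (l < l')%N -> (s l < s l')%N.
Let s_inj : injective s := increasing_inj hs.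

Definition density (x : M.-tuple mR) : R[i] :=
  K * \det (Phi_mx Phi x) * \det (Psi_mx Psi Psibar x) * \prod_(i < M) xi (tnth x i).

Local Notation D := (ordered_region alpha beta (n := M)).
Local Notation DL := (ordered_region alpha beta (n := L)).
Local Notation H := (color_perms (color s) L.+2).
Local Notation bounded x :=
  [forall k in unselected s, in_bounds alpha beta s (selected s x) k (tnth x k)].

Hypothesis density_ge0 : forall x, D x -> 0 <= density x.

Lemma selected_assemble (y : L.-tuple mR) (z : q.-tuple mR) : selected s (assemble y z) = y.
Proof. by apply: eq_from_tnth => l; rewrite tnth_mktuple tnth_assemble_s. Qed.

Lemma density_perm_tuple p (x : M.-tuple mR) : density (perm_tuple p x) = density x.
Proof. exact: density_symmetric. Qed.

(** Nonnegativity spreads from the ordered region by symmetry: sorting inside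
    the blocks moves the point there. *)
Lemma bounded_density_ge0 (x : M.-tuple mR) : DL (selected s x) -> bounded x -> 0 <= density x.
Proof.
move=> dx /forall_inP bx.
have [p pH ps] := color_sorted_exists (color s) L.+2 (tnth x : 'I_M -> R).
rewrite -(density_perm_tuple p); apply: density_ge0.
by rewrite (ordered_region_perm_tuple alpha beta hs).
Qed.

Local Notation g := ((fun x => complex.Re (density x)) \_ D).

(** Only the unique block permutation that sorts [x] contributes. *)
Lemma sum_perm_tuple_density (x : M.-tuple mR) : DL (selected s x) ->
  (forall i j, i \in unselected s -> j \in unselected s -> tnth x i = tnth x j -> i = j) ->
  \sum_(p in H) g (perm_tuple p x) = (if bounded x then complex.Re (density x) else 0).
Proof.
move=> dx xinj.
have gE p : p \in H -> g (perm_tuple p x) =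
    if bounded x && color_sorted (color s) L.+2 ((tnth x : 'I_M -> R) \o p)
    then complex.Re (density x) else 0.
  move=> pH; rewrite patchE density_perm_tuple.
  have -> : (perm_tuple p x \in D) =
      bounded x && color_sorted (color s) L.+2 ((tnth x : 'I_M -> R) \o p).
    apply/idP/idP; rewrite in_setE (ordered_region_perm_tuple alpha beta hs)//.
      by move=> [_ /forall_inP -> ->].
    by move=> /andP[/forall_inP h1 h2].
  by [].
rewrite (eq_bigr _ gE); case: ifP => bx /=; last by rewrite big1.
rewrite -big_mkcondr /=.
have [|p pE] := @color_sorted_unique _ M (color s) L.+2 (tnth x : 'I_M -> R).
  by move=> i j cij ci; apply: xinj; rewrite -(color_lt s) -?cij.
by rewrite (eq_bigl _ _ pE) big_pred1_eq.
Qed.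

(** The factor of the slice [k] in the indicator function of the bounds. *)
Definition bound_weight (x : M.-tuple mR) (k : 'I_N) : R[i] :=
  if insub (k : nat) is Some k' then
    if k' \in unselected s then (in_bounds alpha beta s (selected s x) k' (tnth x k'))%:R else 1
  else 1.

(** The integrand of the tensor [A] at the point [x], each delta function being
    replaced by evaluation at the selected coordinate. *)
Definition bounded_tensor (x : M.-tuple mR) (i j k : 'I_N) : R[i] :=
  bound_weight x k * (varsigma_mx N Phi xi x i k * Psi_mx Psi Psibar x j k).

Lemma prod_bound_weight x : \prod_(k < N) bound_weight x k = (bounded x)%:R.
Proof.
rewrite -prod_indicator.
have [r Nr] : exists r, N = (M + r)%N by exists (N - M)%N; rewrite subnKC.
rewrite /bound_weight; move: hMN; rewrite Nr => _.
rewrite big_split_ord /= [X in _ * X]big1 ?mulr1 => [|k _]; last first.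
  by rewrite insubF// ltnNge leq_addr.
rewrite [RHS]big_mkcond /=.
by apply: eq_bigr => k _; rewrite insub_ord.
Qed.

Lemma pseudo_det_bounded x :
  K * pseudo_det (bounded_tensor x) = (bounded x)%:R * density x.
Proof.
rewrite pseudo_det_scaled prod_bound_weight det_varsigma_mx// /density.
rewrite [LHS]mulrCA; congr (_ * _); rewrite -!mulrA; congr (_ * (_ * _)).
exact: mulrC.
Qed.

Hypothesis integrals_defined : forall x : L.-tuple mR,
  DL x -> forall i j k : 'I_N, (k < M)%N -> (forall l, s l <> k :> nat) ->
  cintegrable (interval_set alpha beta)
    (rect_integrand alpha beta Phi Psi xi s x i j k).

Local Notation A y := (tensorA alpha beta Phi Psi Psibar xi s y).

Lemma has_cintegral_bounded_tensor y (m a : 'S_N) : DL y ->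
  has_cintegral (mu q)
    (fun z => \prod_(k < N) bounded_tensor (assemble y z) (m k) (a k) k)
    (\prod_(k < N) A y (m k) (a k) k).
Proof.
move=> dy.
pose c (b : 'I_q) : 'I_N := widen_ord hMN (enum_val b).
have c_inj : injective c.
  by move=> b b' /(congr1 val) /= /val_inj /enum_val_inj.
have cN b l : s l <> c b :> nat.
  by move=> /val_inj sl; have /unselectedP/(_ l) := enum_valP b; rewrite sl eqxx.
pose g b (t : mR) : R[i] := if (alpha <= t%:E <= beta)%E then
  rect_integrand alpha beta Phi Psi xi s y (m (c b)) (a (c b)) (c b) t else 0.
apply: (@has_cintegral_partial_prod _ N q c _ _ g) => //.
- move=> b z; rewrite /bounded_tensor /bound_weight /g !mxE /=.
  rewrite !insub_ord enum_valP tnth_assemble_unselected// selected_assemble.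
  rewrite /in_bounds; case: ifP => _; last by rewrite mul0r.
  by rewrite /rect_integrand /r_fun /= [RHS]mulrC.
- move=> b; rewrite /tensorA (ltn_ord (enum_val b) : (c b < M)%N).
  case: pickP => [l /eqP/cN//|_].
  apply: has_cintegral_interval; apply: integrals_defined => //.
  exact: (ltn_ord (enum_val b)).
- move=> k z; move=> /unselectedP kc.
  rewrite /bounded_tensor /bound_weight !mxE /tensorA.
  case: insubP => [k' _ kk'|kM]; last first.
    rewrite (negbTE kM) mul1r ltnNge.
    by case: (k <= m k)%N; rewrite ?mul1r ?mul0r.
  rewrite -kk' ltn_ord.
  have : k' \notin unselected s.
    apply/negP => kr; have /eqP := kc (enum_rank_in kr k'); apply.
    by apply: val_inj; rewrite /= enum_rankK_in.
  move=> kr; rewrite (negbTE kr) mul1r.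
  move: kr; rewrite !inE negbK => /imsetP[l _ kl]; rewrite kl.
  case: pickP => [l' /eqP/val_inj/s_inj ->|/(_ l)]; last by rewrite eqxx.
  by rewrite tnth_assemble_s.
Qed.

Lemma has_cintegral_pseudo_det y : DL y ->
  has_cintegral (mu q) (fun z => pseudo_det (bounded_tensor (assemble y z)))
    (pseudo_det (A y)).
Proof.
move=> dy; apply: has_cintegral_sum => m; apply: has_cintegralZ.
apply: has_cintegral_sum => a; apply: has_cintegralZ.
exact: has_cintegral_bounded_tensor.
Qed.

Lemma coef_card_real : coef R s = (#|H|%:R^-1)%:C%C.
Proof. by rewrite coef_card// fmorphV rmorph_nat. Qed.

Local Notation marginal y := (coef R s * K * pseudo_det (A y)).

(** The average over block permutations of the density extended by 0 outside the
    ordered region. It inherits measurability from that extension, while the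
    unrestricted density need only be measurable on the ordered region. *)
Definition symmetrized_density (x : M.-tuple mR) : R :=
  \sum_(p <- enum H) #|H|%:R^-1 * g (perm_tuple p x).

Hypothesis mg : measurable_fun setT g.

Lemma measurable_symmetrized : measurable_fun setT (EFin \o symmetrized_density).
Proof.
apply/measurable_EFinP; apply: measurable_sum => p; apply: measurable_funM => //.
by apply: (measurableT_comp mg); exact: measurable_perm_tuple.
Qed.

Lemma truncated_density_ge0 x : 0 <= g x.
Proof.
rewrite patchE; case: ifPn => // /[!in_setE] /density_ge0.
by rewrite lecE => /andP[].
Qed.

Lemma symmetrized_ge0 x : 0 <= symmetrized_density x.
Proof. by apply: sumr_ge0 => p _; rewrite mulr_ge0 ?invr_ge0 ?truncated_density_ge0. Qed.

(** Events on the selected coordinates are invariant under block permutations,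
    and so is Lebesgue measure; hence all terms of the average have the same
    integral. *)
Lemma symmetrized_mass (B : set (L.-tuple mR)) :
  measurable (selected s @^-1` B) ->
  (\int[mu M]_(x in selected s @^-1` B) (g x)%:E =
   \int[mu M]_x ((EFin \o symmetrized_density) \_ (selected s @^-1` B)) x)%E.
Proof.
set B' := _ @^-1` B => mB'.
pose G := (EFin \o g) \_ B'.
have GE x : G x = if x \in B' then (g x)%:E else 0%E by rewrite /G patchE.
have mG : measurable_fun setT G.
  apply/measurable_restrict => //; rewrite setTI; apply/measurable_EFinP.
  exact: measurable_funTS.
have G0 x : (0 <= G x)%E.
  by rewrite GE; case: ifP => // _; rewrite lee_fin; exact: truncated_density_ge0.
rewrite integral_mkcond.
under [RHS]eq_integral => x _.
  rewrite (_ : _ x = \sum_(p <- enum H) (#|H|%:R^-1)%:E * G (perm_tuple p x))%E; last first.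
    rewrite patchE; case: ifPn => xB /=.
      rewrite /symmetrized_density -sumEFin big_seq [RHS]big_seq; apply: eq_bigr => p.
      rewrite mem_enum => pH; rewrite EFinM GE mem_set//.
      by rewrite /B' /preimage /= color_perms_selected//; move: xB; rewrite in_setE.
    rewrite big_seq big1// => p; rewrite mem_enum => pH.
    rewrite GE memNset ?mule0//.
    rewrite /B' /preimage /= color_perms_selected//.
    by move: xB; rewrite notin_setE.
  over.
rewrite ge0_integral_sum//; last 2 first.
- move=> p; apply: measurable_funeM; apply: (measurableT_comp mG).
  exact: measurable_perm_tuple.
- by move=> p x _; rewrite mule_ge0// lee_fin invr_ge0.
under [RHS]eq_bigr => p _.
  rewrite ge0_integralZl//; last first.
    by apply: (measurableT_comp mG); exact: measurable_perm_tuple.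
  rewrite integral_perm_tuple//.
  over.
rewrite big_const_seq count_predT -cardE.
have H0 : (0 < #|H|)%N by exact: cardG_gt0.
have -> (e : \bar R) n : iter n (+%R e) 0%R = (n%:R%:E * e)%E.
  elim: n => [|n IH]; first by rewrite mul0e.
  by rewrite iterS IH -natr1 EFinD ge0_muleDl ?lee_fin// mul1e addrC.
by rewrite muleA -EFinM mulfV ?mul1e// pnatr_eq0 -lt0n.
Qed.

Lemma symmetrized_out x : ~ DL (selected s x) -> symmetrized_density x = 0.
Proof.
move=> ndx; rewrite /symmetrized_density big_seq big1// => p; rewrite mem_enum => pH.
rewrite patchE memNset ?mulr0//.
by rewrite (ordered_region_perm_tuple alpha beta hs)// => -[].
Qed.

(** The integrand [G] of the formula is nonnegative everywhere, so its integral
    is a nonnegative real number; it agrees with the average off the ties. *)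
Lemma integral_symmetrized y : DL y ->
  0 <= marginal y /\
  (\int[mu q]_z (symmetrized_density (assemble y z))%:E = (complex.Re (marginal y))%:E)%E.
Proof.
move=> dy.
have [Ir Ii] := has_cintegralZ (coef R s * K) (has_cintegral_pseudo_det dy).
pose G (z : q.-tuple mR) : R[i] := coef R s * K * pseudo_det (bounded_tensor (assemble y z)).
have GE z : G z = (#|H|%:R^-1)%:C%C * ((bounded (assemble y z))%:R * density (assemble y z)).
  by rewrite /G -mulrA pseudo_det_bounded coef_card_real.
have G0 z : 0 <= G z.
  rewrite GE mulr_ge0 ?ler0c ?invr_ge0//.
  have [bz|_] := boolP (bounded _); last by rewrite mul0r.
  by rewrite mul1r bounded_density_ge0// selected_assemble.
have ReG z : 0 <= complex.Re (G z) by move: (G0 z); rewrite lecE => /andP[].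
have ImG z : complex.Im (G z) = 0 by move: (G0 z); rewrite lecE => /andP[/eqP].
have [Iri Irv] := Ir; have [Iii Iiv] := Ii.
have vI : complex.Im (marginal y) = 0.
  by apply: EFin_inj; rewrite -Iiv; apply: integral0_eq => z _; rewrite [complex.Im _]ImG.
have vR : 0 <= complex.Re (marginal y).
  by rewrite -lee_fin -Irv; apply: integral_ge0 => z _; rewrite lee_fin; exact: ReG.
split; first by rewrite lecE vI eqxx vR.
rewrite -Irv; apply: ge0_ae_eq_integral => //.
- apply: (measurableT_comp measurable_symmetrized); exact: measurable_assemble_r.
- exact: (measurable_int _ Iri).
- by move=> z _; rewrite lee_fin symmetrized_ge0.
- by move=> z _; rewrite lee_fin; exact: ReG.
have ties : {ae mu q, forall z, forall b b' : 'I_q, tnth z b = tnth z b' -> b = b'}.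
  apply: filter_forall => b; apply: filter_forall => b'.
  have [->|bb'] := eqVneq b b'; first exact: aeW.
  exists [set z | tnth z b = tnth z b']; split; [exact: measurable_tie|exact: tie_null|].
  by move=> z /= /not_implyP[].
move: ties; apply: filterS => z zinj _; congr EFin.
rewrite -[RHS]/(complex.Re (G z)) GE Re_mul /= mul0r subr0.
rewrite /symmetrized_density -mulr_sumr big_enum sum_perm_tuple_density ?selected_assemble//.
  by case: [forall _ in _, _]; rewrite ?mul1r ?mul0r.
move=> i j ir jr; rewrite -(enum_rankK_in ir ir) -(enum_rankK_in jr jr).
by rewrite !tnth_assemble_unselected// => /zinj ->.
Qed.

End Marginal.

Theorem theorem2p2 (R : realType) (d : measure_display) (T : measurableType d)
    (P : probability T R) (M N : nat) (hM : (1 <= M)%N) (hMN : (M <= N)%N)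
    (alpha beta : \bar R) (hab : (alpha < beta)%E)
    (lambda : 'I_M -> {RV P >-> R})
    (lambda_ordered : {ae P, forall w,
        ordered_region alpha beta [tuple lambda i w | i < M]})
    (K : R[i]) (Phi : 'I_M -> R -> R[i]) (Psi : 'I_N -> R -> R[i])
    (Psibar : 'I_N -> 'I_N -> R[i]) (xi : R -> R[i])
    (lambda_pdf : joint_pdf_on lambda (ordered_region alpha beta (n := M))
        (fun x => K * \det (Phi_mx Phi x) * \det (Psi_mx Psi Psibar x) *
                  \prod_(i < M) xi (tnth x i)))
    (L : nat) (hL : (1 <= L <= M)%N) (s : 'I_L -> 'I_M)
    (hs : forall l l' : 'I_L, (l < l')%N -> (s l < s l')%N)
    (integrals_defined : forall x : L.-tuple (measurableTypeR R),
        ordered_region alpha beta x ->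
        forall i j k : 'I_N, (k < M)%N -> (forall l, s l <> k :> nat) ->
        cintegrable (interval_set alpha beta)
          (rect_integrand alpha beta Phi Psi xi s x i j k)) :
  joint_pdf_on (fun l => lambda (s l)) (ordered_region alpha beta (n := L))
    (fun x => coef R s * K *
              pseudo_det (tensorA alpha beta Phi Psi Psibar xi s x)).
Proof.
have [f_ge0 mg fP] := lambda_pdf.
pose DL := ordered_region alpha beta (n := L).
pose sd := symmetrized_density alpha beta K Phi Psi Psibar xi s.
pose marg y := coef R s * K * pseudo_det (tensorA alpha beta Phi Psi Psibar xi s y).
have key y (dy : DL y) := integral_symmetrized hMN hs f_ge0 integrals_defined mg dy.
have s_inj := increasing_inj hs.
have msd : measurable_fun setT (EFin \o sd) := measurable_symmetrized s mg.
have sd0 x : 0 <= sd x := symmetrized_ge0 s f_ge0 x.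
pose gL := (fun y => complex.Re (marg y)) \_ DL.
(* The density is an integral over the remaining coordinates at every point,
   including outside the ordered region, where both sides vanish. *)
have gLE y : (\int[tuple_lebesgue R #|unselected s|]_z (sd (assemble y z))%:E = (gL y)%:E)%E.
  rewrite /gL patchE; case: ifPn => [|]; rewrite ?in_setE ?notin_setE => dy.
    by have [_ ->] := key _ dy.
  apply: integral0_eq => z _; rewrite [sd _]symmetrized_out//.
  by rewrite selected_assemble.
have mgL : measurable_fun setT gL.
  apply/measurable_EFinP; rewrite (_ : _ \o _ = fun y =>
    \int[tuple_lebesgue R #|unselected s|]_z (EFin \o sd) (assemble y z))%E.
    apply: measurable_integral_assemble => // x; rewrite lee_fin; exact: sd0.
  by apply/funext => y /=; rewrite -gLE.
split => //; first by move=> y dy; have [] := key _ dy.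
move=> B mB.
pose B' := selected s @^-1` B.
have mB' : measurable B' by rewrite -[B']setTI; exact: measurable_selected.
transitivity (P [set w | B' [tuple lambda i w | i < M]]).
  congr (P _); apply/seteqP; split => w; rewrite /B' /=;
    by rewrite (_ : selected s _ = [tuple lambda (s i) w | i < L])//;
       apply: eq_from_tnth => l; rewrite !tnth_mktuple.
rewrite fP//.
rewrite (symmetrized_mass f_ge0 mg mB').
rewrite (integral_assemble s_inj)//; last 2 first.
- by apply/measurable_restrict => //; rewrite setTI; exact: measurable_funTS.
- by move=> x; rewrite patchE; case: ifP => // _; rewrite lee_fin.
rewrite [RHS]integral_mkcond; apply: eq_integral => y _.
rewrite patchE; case: ifPn => yB.
  rewrite -gLE; apply: eq_integral => z _.
  by rewrite patchE mem_set// /B' /preimage /= selected_assemble//; move: yB; rewrite in_setE.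
apply: integral0_eq => z _; rewrite patchE memNset//.
by rewrite /B' /preimage /= selected_assemble//; move: yB; rewrite notin_setE.
Qed.
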